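(* Let $\{a_n\}_{n=1}^\infty$ and $\{b_n\}_{n=1}^\infty$ be any sequences of (real or complex) numbers such that \[ \sum_{k=1}^n \binom{n}{k} (-1)^{k-1} a_k=b_n \quad \text{for all } n \ge 1. \] Then for all integers $n\ge1$ and $m \ge 1$, \[ \sum_{k=1}^{n}\binom{n}{k}(-1)^{k-1}\frac{a_{k}}{k^{m}}=\sum_{1\le k_1 \le k_2\le \cdots \le k_m\le n} \frac{b_{k_{1}}}{k_{1}k_{2}\cdots k_{m}}, \] where the sum on the right runs over all integer tuples $(k_1,\dots,k_m)$ with $1\le k_1\le k_2\le\cdots\le k_m\le n$. *)

(* Defs.v *)
From mathcomp Require Export all_boot all_order all_algebra.

Set Implicit Arguments.
Unset Strict Implicit.
Unset Printing Implicit Defensive.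

(* The tuples (k_1, ..., k_m) with 1 <= k_1 <= k_2 <= ... <= k_m <= n:
   entries are taken in 'I_n.+1 = {0, ..., n}, which gives the upper bound,
   and [path leq 1] is the chain 1 <= k_1 <= ... <= k_m. *)
Definition chain_from1 (n m : nat) (k : m.-tuple 'I_n.+1) : bool :=
  path leq 1 [seq nat_of_ord i | i <- k].

(* Main.v *)
(* Let S a n be the alternating binomial sum of a.  Pascal's rule and absorption
   give S (a_k / k) n.+1 - S (a_k / k) n = S a n.+1 / n.+1, so dividing a by k
   turns S a into the partial sums of (S a) j / j.  Iterating m times produces
   the nested sums on the right, where each step sums out the innermost
   variable k_1 <= k_2. *)
Require Import Defs.
From mathcomp Require Import all_boot all_order all_algebra.
From mathcomp Require Import ring.

Import GRing.Theory Num.Theory.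
Local Open Scope ring_scope.

Section AlternatingBinomialSum.
Variable F : numFieldType.
Implicit Types a b : nat -> F.

Definition alt_binom_sum a (n : nat) : F :=
  \sum_(1 <= k < n.+1) 'C(n, k)%:R * (-1) ^+ (k - 1)%N * a k.

Definition harmonic_sum b (n : nat) : F := \sum_(1 <= j < n.+1) b j / j%:R.

Lemma alt_binom_sumS a (n : nat) :
  alt_binom_sum (fun k => a k / k%:R) n.+1 =
  alt_binom_sum (fun k => a k / k%:R) n + alt_binom_sum a n.+1 / n.+1%:R.
Proof.
(* The sum at [n] gains the term [k = n.+1], which vanishes since ['C(n, n.+1) = 0]; both sums then
   share one range. *)
have -> : alt_binom_sum (fun k => a k / k%:R) n =
    \sum_(1 <= k < n.+2) 'C(n, k)%:R * (-1) ^+ (k - 1)%N * (a k / k%:R).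
  by rewrite big_nat_recr //= bin_small // !mul0r addr0.
rewrite /alt_binom_sum mulr_suml -big_split /=.
apply: eq_big_nat => -[//|k] _.
have absorb : 'C(n.+1, k.+1)%:R / n.+1%:R = 'C(n, k)%:R / k.+1%:R :> F.
  by apply/eqP; rewrite eqr_div ?pnatr_eq0 // -!natrM mulnC -mul_bin_diag mulnC.
rewrite [X in _ + X](_ : _ =
    'C(n.+1, k.+1)%:R / n.+1%:R * ((-1) ^+ (k.+1 - 1)%N * a k.+1)); last by ring.
by rewrite absorb binS natrD; ring.
Qed.

Lemma alt_binom_sum_div a (n : nat) :
  alt_binom_sum (fun k => a k / k%:R) n = harmonic_sum (alt_binom_sum a) n.
Proof.
elim: n => [|n IHn]; first by rewrite /alt_binom_sum /harmonic_sum !big_geq.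
by rewrite alt_binom_sumS IHn /harmonic_sum [RHS]big_nat_recr.
Qed.

(** The head is the inner variable, so that [k_1] can be summed out with [k_2], ..., [k_m] fixed. *)
Lemma big_tuple_cons (T : finType) (m : nat) (P : pred (m.+1.-tuple T))
    (f : m.+1.-tuple T -> F) :
  \sum_(t | P t) f t =
  \sum_(t : m.-tuple T) \sum_(x | P (cons_tuple x t)) f (cons_tuple x t).
Proof.
rewrite pair_big_dep /=.
rewrite (reindex (fun p : m.-tuple T * T => cons_tuple p.2 p.1)) //=.
exists (fun t => (behead_tuple t, thead t)) => [[t x]|t] _ /=.
  by congr pair; apply/val_inj.
by rewrite [RHS]tuple_eta; apply/val_inj.
Qed.

(** The length is [m.+1] so that the first entry always exists, at [ord0]. *)
Definition chain_sum b (N m : nat) : F :=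
  \sum_(k : m.+1.-tuple 'I_N.+1 | chain_from1 k)
     b (tnth k ord0) / \prod_(i < m.+1) (tnth k i : nat)%:R.

Lemma harmonic_sum_ord b (N : nat) (y : 'I_N.+1) :
  harmonic_sum b y = \sum_(x < N.+1 | (1 <= x <= y)%N) b x / (x : nat)%:R.
Proof.
rewrite /harmonic_sum big_nat_cond (big_nat_widen _ _ N.+1) //.
rewrite big_geq_mkord /=; apply: eq_bigl => x.
by rewrite ltnS; case: (1 <= x)%N; case: (x <= y)%N.
Qed.

Lemma chain_sum1 b (N : nat) : chain_sum b N 0 = harmonic_sum b N.
Proof.
rewrite (harmonic_sum_ord b N ord_max) /chain_sum big_tuple_cons.
rewrite (big_pred1 [tuple]) => [|t]; last by apply/esym/eqP; exact: tuple0.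
apply: eq_big => [x|x _].
  by rewrite /chain_from1 /= leq_ord.
by rewrite big_ord1.
Qed.

(** For a fixed tail, summing [b k_1 / k_1] over [1 <= k_1 <= k_2] gives [harmonic_sum b k_2], which
    takes the place of [b] in the shorter chain. *)
Lemma chain_sumS b (N m : nat) :
  chain_sum b N m.+1 = chain_sum (harmonic_sum b) N m.
Proof.
rewrite /chain_sum big_tuple_cons [RHS]big_mkcond /=.
apply: eq_bigr => t _.
rewrite [tnth t ord0](_ : _ = thead t) //.
have chainE x : chain_from1 (cons_tuple x t) =
    (1 <= x <= thead t)%N && path leq (thead t) [seq nat_of_ord i | i <- behead t].
  by rewrite /chain_from1 [t]tuple_eta /= theadE andbA.
have chaintE : chain_from1 t =
    (1 <= thead t)%N && path leq (thead t) [seq nat_of_ord i | i <- behead t].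
  by rewrite /chain_from1 [t]tuple_eta /= theadE.
under eq_bigl => x do rewrite chainE.
rewrite chaintE.
case: (path _ _ _); last by rewrite andbF big_pred0 // => x; rewrite andbF.
under eq_bigl => x do rewrite andbT.
rewrite andbT.
rewrite (_ : (if _ then ?[u] else 0) = ?u); last first.
  by case: posnP => // ->; rewrite /harmonic_sum big_geq // mul0r.
rewrite harmonic_sum_ord mulr_suml; apply: eq_bigr => x _.
rewrite [in LHS]big_ord_recl invfM mulrA.
by under [in LHS]eq_bigr => i _ do rewrite tnthS.
Qed.

(** Induction on [m] with [a] general: one factor [1 / k] is absorbed into the sequence, and the
    hypothesis is applied to [a k / k]. *)
Lemma alt_binom_sum_div_exp a (n m : nat) :
  alt_binom_sum (fun k => a k / k%:R ^+ m.+1) n = chain_sum (alt_binom_sum a) n m.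
Proof.
elim: m a => [|m IHm] a; first by rewrite chain_sum1 -alt_binom_sum_div.
rewrite chain_sumS.
have -> : chain_sum (harmonic_sum (alt_binom_sum a)) n m =
          chain_sum (alt_binom_sum (fun k => a k / k%:R)) n m.
  by apply: eq_bigr => k _; rewrite alt_binom_sum_div.
rewrite -IHm; apply: eq_bigr => k _.
by rewrite [in LHS]exprS invfM !mulrA.
Qed.

End AlternatingBinomialSum.

(* MathComp. Any numFieldType F covers both the real and the complex numbers.
   Sequences are indexed from 1: the values a 0 and b 0 are never used. *)
Theorem theorem2p5 (F : numFieldType) (a b : nat -> F)
  (hab : forall n : nat, (1 <= n)%N ->
     \sum_(1 <= k < n.+1) 'C(n, k)%:R * (-1) ^+ (k - 1)%N * a k = b n)
  (n m : nat) (hn : (1 <= n)%N) (hm : (1 <= m)%N) :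
  \sum_(1 <= k < n.+1) 'C(n, k)%:R * (-1) ^+ (k - 1)%N * (a k / k%:R ^+ m) =
  \sum_(k : m.-tuple 'I_n.+1 | chain_from1 k)
     b (tnth k (Ordinal hm)) / \prod_(i < m) (tnth k i : nat)%:R.
Proof.
case: m hm => [//|m] hm; rewrite [LHS](alt_binom_sum_div_exp F a n m).
(* The chain condition gives [1 <= k_1], as [hab] requires. *)
apply: eq_bigr => k; rewrite /chain_from1 [k]tuple_eta /= => /andP[k1 _].
rewrite (_ : Ordinal hm = ord0); last exact: val_inj.
by rewrite -hab.
Qed.
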